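(* Let $N\ge 3$, let $\pi_{a,b}(k)=ak^2+bk \pmod N$ be a normalized quadratic permutation polynomial (QPP) over $\mathbb Z_N$, let $u\in\mathbb Z$ with $\gcd(u,N)=1$, and let $q\in\mathbb Z$. Then the sequence $y_{u,q}^{a,b}(k)=z_{u,q,N}(\pi_{a,b}(k))$, $k\in\mathbb Z_N$, is equivalent to a Zadoff--Chu sequence (is Zadoff--Chu-equivalent) if and only if, for each prime power $p^\alpha\Vert N$ (with $p$ a prime dividing $N$), $$\nu_p(a)\ge \eta(p,\alpha),$$ where $$\eta(p,\alpha)=\begin{cases}0,& p=2,\ \alpha=1,\\ \alpha-1,& p=2,\ \alpha\ge 2,\\ \alpha-1,& p=3,\\ \alpha,& p>3.\end{cases}$$
   Context: Write $\mathbb Z_N=\mathbb Z/N\mathbb Z$, $\zeta_N=\exp(-\pi\sqrt{-1}/N)$, $W_N=\zeta_N^2=\exp(-2\pi\sqrt{-1}/N)$, and $\varepsilon_N=N\bmod 2\in\{0,1\}$. For $u\in\mathbb Z$ with $\gcd(u,N)=1$ and $q\in\mathbb Z$, the length-$N$ Zadoff--Chu sequence is $z_{u,q,N}(t)=\zeta_N^{u(t+\varepsilon_N+2q)t}$; this depends only on $t$ modulo $N$, so it is a function on $\mathbb Z_N$. A normalized QPP over $\mathbb Z_N$ is a polynomial $\pi_{a,b}(X)=aX^2+bX$ with $a,b\in\mathbb Z_N$ (zero constant term; $a=0$ allowed) such that $k\mapsto \pi_{a,b}(k)$ is a permutation of $\mathbb Z_N$. Equivalence is under the five operations on sequences $s:\mathbb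 Z_N\to\mathbb C$: $s(k)\mapsto c\,s(k)$ with $|c|=1$; $s(k)\mapsto s(k+d)$ with $d\in\mathbb Z_N$; $s(k)\mapsto s(rk)$ with $r\in\mathbb Z_N^\times$; $s(k)\mapsto W_N^{\lambda k}s(k)$ with $\lambda\in\mathbb Z_N$; $s(k)\mapsto\overline{s(k)}$. Equivalently, a sequence $s$ on $\mathbb Z_N$ is Zadoff--Chu-equivalent if there exist $\sigma\in\{\pm1\}$, $r\in\mathbb Z_N^\times$, $d,\lambda\in\mathbb Z_N$, $u'$ coprime to $N$, $q'$, and a unimodular constant $c$ such that $s(k)=c\,W_N^{\lambda k}\,\zeta_N^{\sigma u'(rk+d+\varepsilon_N+2q')(rk+d)}$ for all $k\in\mathbb Z_N$. $p^\alpha\Vert N$ means $p^\alpha\mid N$ and $p^{\alpha+1}\nmid N$. $\nu_p$ is the $p$-adic valuation, $\nu_p(0)=\infty$. For a residue class $a$ modulo $N$ with $p^\alpha\Vert N$ and $0\le t\le\alpha$, $\nu_p(a)\ge t$ means that the image of $a$ in $\mathbb Z_{p^\alpha}$ is divisible by $p^t$; in particular $\nu_p(a)\ge\alpha$ means $a\equiv 0\pmod{p^\alpha}$. *)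

(* Defs.v *)
(* MathComp world, with MathComp-Analysis for pi, cos and sin: the complex
   numbers are R[i] over an arbitrary R : realType. *)
From HB Require Import structures.
From mathcomp Require Import all_boot all_order all_algebra.
From mathcomp Require Import reals trigo.
From mathcomp Require Import complex ring.
Set Implicit Arguments.
Unset Strict Implicit.
Unset Printing Implicit Defensive.
Import Order.TTheory GRing.Theory Num.Theory.
Local Open Scope ring_scope.
Local Open Scope complex_scope.

(* exp (- pi i / N), by Euler's formula *)
Definition zeta (R : realType) (N : nat) : R[i] :=
  cos (pi / N%:R) -i* sin (pi / N%:R).

Definition W (R : realType) (N : nat) : R[i] := zeta R N ^+ 2.

Definition zc_val (R : realType) (N : nat) (u q t : int) : R[i] :=
  zeta R N ^ (u * (t + (N %% 2)%N%:Z + q *+ 2) * t).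

Lemma zeta_neq0 (R : realType) (N : nat) : zeta R N != 0.
Proof.
apply/eqP => /eqP; rewrite eq_complex /= oppr_eq0 => /andP[/eqP c0 /eqP s0].
have := cos2Dsin2 (pi / N%:R : R); rewrite c0 s0 expr0n /= addr0 => /esym/eqP.
by rewrite oner_eq0.
Qed.

Lemma zetaX (R : realType) (N n : nat) :
  zeta R N ^+ n = cos (pi / N%:R *+ n) -i* sin (pi / N%:R *+ n).
Proof.
elim: n => [|n IHn]; first by rewrite expr0 mulr0n cos0 sin0 oppr0.
rewrite exprSr IHn mulrSr cosD sinD; apply/eqP; rewrite eq_complex /=.
by apply/andP; split; apply/eqP; ring.
Qed.

(* z_{u,q,N} is a function on Z/NZ: its value at a class is the value of zc_val
   at any representative. *)
Lemma zc_val_periodic (R : realType) (N : nat) (u q t : int) :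
  (0 < N)%N -> zc_val R N u q (t + N%:Z) = zc_val R N u q t.
Proof.
move=> N0; rewrite /zc_val.
have zN : zeta R N ^ (N * 2)%N%:Z = 1.
  rewrite -exprnP zetaX mulrnA -[X in X *+ 2]mulr_natr divfK ?pnatr_eq0 -?lt0n//.
  by rewrite cos2pi sin2pi oppr0.
have -> : u * (t + N%:Z + (N %% 2)%N%:Z + q *+ 2) * (t + N%:Z) =
    u * (t + (N %% 2)%N%:Z + q *+ 2) * t +
    (N * 2)%N%:Z * (u * (t + (N./2)%:Z + (N %% 2)%N%:Z + q)).
  have EN : N%:Z = (N %% 2)%N%:Z + (N./2)%:Z *+ 2.
    by rewrite -[in LHS](odd_double_half N) modn2 PoszD -addnn PoszD mulr2n.
  rewrite PoszM; set h := (N./2)%:Z in EN *; set e := (N %% 2)%N%:Z in EN *.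
  by rewrite EN; ring.
by rewrite expfzDr ?zeta_neq0// -(exprz_exp _ (N * 2)%N%:Z) zN exp1rz mulr1.
Qed.

(* Throughout, 'Z_N is Z/NZ only for 1 < N, and elements of 'Z_N are coerced to
   nat through their representative in [0, N). *)
Definition zc_seq (R : realType) (N : nat) (u q : int) : {ffun 'Z_N -> R[i]} :=
  [ffun t : 'Z_N => zc_val R N u q (val t)%:Z].

Definition qpp (N : nat) (a b k : 'Z_N) : 'Z_N := a * k ^+ 2 + b * k.

Definition is_qpp (N : nat) (a b : 'Z_N) : Prop := bijective (qpp a b).

(* Each of the five families of operations is closed under inverses, so the
   relation generated in this way is an equivalence relation. *)
Inductive seq_equiv (R : realType) (N : nat) (s : {ffun 'Z_N -> R[i]}) :
    {ffun 'Z_N -> R[i]} -> Prop :=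
| SeqEquivRefl : seq_equiv s s
| SeqEquivScale (s' : {ffun 'Z_N -> R[i]}) (c : R[i]) :
    seq_equiv s s' -> `|c| = 1 -> seq_equiv s [ffun k => c * s' k]
| SeqEquivShift (s' : {ffun 'Z_N -> R[i]}) (d : 'Z_N) :
    seq_equiv s s' -> seq_equiv s [ffun k => s' (k + d)]
| SeqEquivDecimate (s' : {ffun 'Z_N -> R[i]}) (r : 'Z_N) :
    seq_equiv s s' -> r \is a GRing.unit -> seq_equiv s [ffun k => s' (r * k)]
| SeqEquivModulate (s' : {ffun 'Z_N -> R[i]}) (l : 'Z_N) :
    seq_equiv s s' ->
    seq_equiv s [ffun k : 'Z_N => W R N ^+ (val l * val k)%N * s' k]
| SeqEquivConj (s' : {ffun 'Z_N -> R[i]}) :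
    seq_equiv s s' -> seq_equiv s [ffun k => (s' k)^*].

Definition zc_equivalent (R : realType) (N : nat) (s : {ffun 'Z_N -> R[i]}) :
    Prop :=
  exists u' q' : int, coprimez u' N%:Z /\ seq_equiv (zc_seq R N u' q') s.

Definition qpp_zc (R : realType) (N : nat) (u q : int) (a b : 'Z_N) :
    {ffun 'Z_N -> R[i]} :=
  [ffun k => zc_seq R N u q (qpp a b k)].

Definition exactly_divides (p alpha N : nat) : bool :=
  (p ^ alpha %| N)%N && ~~ (p ^ alpha.+1 %| N)%N.

(* nu_p(a) >= t, for p^alpha || N with 0 < alpha and t <= alpha: the image of a
   in Z/p^alpha Z is a multiple of p^t. *)
Definition nu_ge (N p alpha : nat) (a : 'Z_N) (t : nat) : Prop :=
  exists c : 'Z_(p ^ alpha), (val a)%:R = (p ^ t)%:R * c.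

(* only used for p prime *)
Definition eta (p alpha : nat) : nat :=
  if p == 2%N then (if alpha == 1%N then 0 else alpha - 1)%N
  else if p == 3%N then (alpha - 1)%N
  else alpha.

(* Main.v *)
Require Import Defs.
From mathcomp Require Import all_boot all_order all_algebra.
From mathcomp Require Import reals.
From mathcomp Require Import trigo complex ring lra zify.

(** Write e = N mod 2 and P(k) = a k^2 + b k, so that the permuted sequence is
    zeta^E(k) with E = u (P + e + 2q) P and zeta of order 2N.  The five
    operations preserve the set of sequences c zeta^(A k^2 + B k), on which third
    differences of the exponent vanish modulo 2N; the third difference of E at 0
    is 12 u a (3a + b).  Bijectivity of P makes 3a + b prime to N, so an
    equivalence forces N | 6a.  Conversely
      E(k) = D k^2 + B k + u a k (k-1) (k-2) (a (k+3) + 2b)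
    where the last term vanishes modulo 2N when N | 6a, D is prime to N, and the
    linear term can be absorbed in the parameter q'; so the permuted sequence is
    itself a Zadoff-Chu sequence.  Finally N | 6a unfolds prime by prime into the
    stated bounds on the valuations of a. *)

Import Order.TTheory GRing.Theory Num.Theory.
Local Open Scope ring_scope.

(** * Divisibility and coprimality of integers *)

Lemma Euclid_dvdzM (p : nat) (m n : int) :
  prime p -> (p%:Z %| m * n)%Z = (p%:Z %| m)%Z || (p%:Z %| n)%Z.
Proof. by move=> pp; rewrite !dvdzE abszM Euclid_dvdM. Qed.

Lemma dvdz_addr (d m n : int) :
  (d %| m)%Z -> (d %| m + n)%Z = (d %| n)%Z.
Proof. exact: rpredDl. Qed.

Lemma coprimez_primeP (m : int) (N : nat) : (0 < N)%N ->
  coprimez m N%:Z <->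
  (forall p, prime p -> (p %| N)%N -> ~~ (p%:Z %| m)%Z).
Proof.
move=> N0; rewrite coprimezE; split=> [co p pp pN|H].
  by rewrite dvdzE -prime_coprime// coprime_sym (coprime_dvdr pN co).
rewrite /coprime; apply: contraT => g1.
have g0 : (0 < gcdn `|m| N)%N by rewrite gcdn_gt0 N0 orbT.
have pp : prime (pdiv (gcdn `|m| N)).
  by rewrite pdiv_prime// ltn_neqAle eq_sym g1.
have pd := pdiv_dvd (gcdn `|m| N).
have := H _ pp (dvdn_trans pd (dvdn_gcdr _ _)).
by rewrite dvdzE (dvdn_trans pd (dvdn_gcdl _ _)).
Qed.

Lemma coprimez_solve (c n d : int) :
  coprimez c n -> exists x, (n %| x * c - d)%Z.
Proof.
move=> /coprimezP[[x y] /= e]; exists (d * x); apply/dvdzP; exists (- d * y).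
by rewrite -[X in _ - X = _]mulr1 -e; ring.
Qed.

Lemma dvdz2_mulB1 (k : int) : (2 %| k * (k - 1))%Z.
Proof. by rewrite Euclid_dvdzM//; lia. Qed.

Lemma dvdz6_falling (k : int) : (6 %| k * (k - 1) * (k - 2))%Z.
Proof.
have : (2 %| k * (k - 1) * (k - 2))%Z by rewrite dvdz_mulr// dvdz2_mulB1.
have : (3 %| k * (k - 1) * (k - 2))%Z by rewrite !Euclid_dvdzM//; lia.
lia.
Qed.

Lemma dvdz12_falling (k : int) : (12 %| k * (k - 1) * (k - 2) * (k + 3))%Z.
Proof.
have : (4 %| (k * (k - 1)) * ((k - 2) * (k + 3)))%Z.
  (* Each of k (k - 1) and (k - 2) (k + 3) is even. *)
  by apply: (@dvdz_mul 2 2); [exact: dvdz2_mulB1 | rewrite Euclid_dvdzM//; lia].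
rewrite !mulrA.
have : (3 %| k * (k - 1) * (k - 2) * (k + 3))%Z by rewrite !Euclid_dvdzM//; lia.
lia.
Qed.

(** * Residues modulo N and their integer representatives *)

Section Zp_int.
Context {N : nat} (N1 : (1 < N)%N).

Lemma intr_Zp_eq0 (m : int) : (m%:~R == 0 :> 'Z_N) = (N%:Z %| m)%Z.
Proof.
have natE (n : nat) : (n%:R == 0 :> 'Z_N) = (N %| n)%N.
  by rewrite -val_eqE /= val_Zp_nat.
by case: m => n; rewrite ?NegzE ?mulrNz ?oppr_eq0 -pmulrn natE dvdzE ?abszN.
Qed.

Lemma eq_intr_Zp (m n : int) :
  (m%:~R == n%:~R :> 'Z_N) = (N%:Z %| m - n)%Z.
Proof. by rewrite -subr_eq0 -intrB intr_Zp_eq0. Qed.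

Lemma val_intr_Zp (x : 'Z_N) : (val x)%:Z%:~R = x.
Proof. by rewrite -pmulrn natr_Zp. Qed.

End Zp_int.

(** * Quadratic permutation polynomials *)

(** An integer lift: exponents of [zeta] matter modulo 2N, so they cannot be computed in ['Z_N]. *)
Definition qppz (a b k : int) : int := a * k ^+ 2 + b * k.

Lemma qpp_intr (N : nat) (a b : 'Z_N) (k : int) :
  qpp a b k%:~R = (qppz (val a)%:Z (val b)%:Z k)%:~R.
Proof. by rewrite /qpp /qppz intrD !intrM !val_intr_Zp. Qed.

Section QPP.
Context {N : nat} {a b : 'Z_N}.
Hypotheses (N1 : (1 < N)%N) (ab : is_qpp a b).
Let a' := (val a)%:Z.
Let b' := (val b)%:Z.

(** Modulo 2 the polynomial is (a + b) x; if a + b were even, no value would be odd and 1 would have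
    no preimage. *)
Lemma qpp_sum_odd : (2 %| N)%N -> ~~ (2 %| a' + b')%Z.
Proof.
move=> N2; case: ab => g _ gK; have := gK 1; set k := g 1.
rewrite -(val_intr_Zp k) qpp_intr => /eqP.
rewrite -[1]/(1%:~R) eq_intr_Zp// => /(dvdz_trans (N2 : (2 %| N%:Z)%Z)).
rewrite -/a' -/b' /qppz; have := dvdz2_mulB1 (val k)%:Z.
move: (val k)%:Z => x /dvdzP[c Hc] /dvdzP[d Hd]; apply/negP => /dvdzP[e He].
have : 1 = a' * (x * (x - 1)) + (a' + b') * x - (a' * x ^+ 2 + b' * x - 1).
  by ring.
by rewrite Hc Hd He mulrA (mulrAC e) -mulrDl -mulrBl; lia.
Qed.

(* Two residues that differ by N/p collide exactly when the slope
   2ax + aN/p + b vanishes modulo p. *)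
Lemma qpp_slope (p : nat) (x : int) : prime p -> (p %| N)%N ->
  ~~ (p%:Z %| x * (2 * a') + (a' * (N %/ p)%N%:Z + b'))%Z.
Proof.
move=> pp pN; set M := (N %/ p)%N; apply/negP => /dvdzP[c Hc].
have NE : N%:Z = p%:Z * M%:Z by rewrite -PoszM mulnC divnK.
have /(bij_inj ab)/eqP : qpp a b (x + M%:Z)%:~R = qpp a b x%:~R.
  apply/eqP; rewrite !qpp_intr eq_intr_Zp//; apply/dvdzP; exists c.
  rewrite -/a' -/b' NE mulrA -Hc /qppz; ring.
rewrite eq_intr_Zp// addrC addKr dvdzE /= gtnNdvd//.
  by rewrite divn_gt0 ?prime_gt0// dvdn_leq// ltnW.
by rewrite ltn_Pdiv ?prime_gt1// ltnW.
Qed.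

(** Otherwise 2a is invertible modulo p, and some x makes the slope of [qpp_slope] vanish. *)
Lemma qpp_lead_dvd (p : nat) : prime p -> (p %| N)%N -> p != 2%N ->
  (p%:Z %| a')%Z.
Proof.
move=> pp pN p2; apply: contraT => pa.
have co : coprimez (2 * a') p%:Z.
  apply/coprimez_primeP; rewrite ?prime_gt0// => r pr.
  rewrite dvdn_prime2// => /eqP->; rewrite Euclid_dvdzM// negb_or pa andbT.
  by rewrite dvdzE /= dvdn_prime2.
have [x Hx] := @coprimez_solve _ _ (- (a' * (N %/ p)%N%:Z + b')) co.
by have := qpp_slope _ x pp pN; rewrite opprK in Hx; rewrite Hx.
Qed.

Lemma qpp_lin_ndvd (p : nat) : prime p -> (p %| N)%N -> p != 2%N ->
  ~~ (p%:Z %| b')%Z.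
Proof.
move=> pp pN p2; have := qpp_slope _ 0 pp pN.
by rewrite mul0r add0r dvdz_addr// dvdz_mulr// qpp_lead_dvd.
Qed.

End QPP.

(** * The order of [zeta] *)

Section Zeta.
Context (R : realType) (N : nat).
Hypothesis N0 : (0 < N)%N.

Lemma cos_neq1_lt2pi (x : R) : 0 < x < pi *+ 2 -> cos x != 1.
Proof.
move=> /andP[x0 x2]; have s0 : 0 < sin (x / 2).
  by rewrite sin_gt0_pi// divr_gt0//= ltr_pdivrMr// mulr_natr.
have -> : x = x / 2 *+ 2 by rewrite -mulr_natr divfK// pnatr_eq0.
rewrite cos_mulr2n cos2sin2; apply/eqP => e.
have : sin (x / 2) ^+ 2 = 0 by lra.
by move/eqP; rewrite sqrf_eq0 gt_eqF.
Qed.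

(** Reduce m modulo 2N: a nonzero remainder gives an angle strictly between 0 and 2 pi, where the
    cosine is not 1. *)
Lemma zeta_expz_eq1 (m : int) : (zeta R N ^ m == 1) = ((N * 2)%N%:Z %| m)%Z.
Proof.
have zN : zeta R N ^ (N * 2)%N%:Z = 1.
  rewrite -exprnP zetaX mulrnA -[X in X *+ 2]mulr_natr divfK ?pnatr_eq0 -?lt0n//.
  by rewrite cos2pi sin2pi oppr0.
have M0 : (N * 2)%N%:Z != 0 by rewrite eqz_nat -lt0n muln_gt0 N0.
have mE : zeta R N ^ m = zeta R N ^ (m %% (N * 2)%N%:Z)%Z.
  rewrite {1}(divz_eq m (N * 2)%N%:Z) expfzDr ?zeta_neq0// mulrC
    (mulrC (_ %/ _)%Z).
  by rewrite -exprz_exp zN exp1rz mulr1.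
rewrite mE (sameP dvdz_mod0P eqP).
have := ltz_mod m M0; have := modz_ge0 m M0.
case: (m %% _)%Z => // -[|n] _ ltn; first by rewrite expr0z eqxx.
rewrite -exprnP zetaX eq_complex /= (negPf (cos_neq1_lt2pi _ _))//.
rewrite pmulrn_lgt0// divr_gt0 ?pi_gt0 ?ltr0n//= -[_ *+ n.+1]mulr_natr.
rewrite -[pi *+ 2]mulr_natr -mulrA ltr_pM2l ?pi_gt0// mulrC ltr_pdivrMr ?ltr0n//.
by rewrite -natrM ltr_nat mulnC.
Qed.

Lemma eq_zeta_expz (m n : int) :
  (zeta R N ^ m == zeta R N ^ n) = ((N * 2)%N%:Z %| m - n)%Z.
Proof.
rewrite -zeta_expz_eq1 -{1}(subrK n m) expfzDr ?zeta_neq0//.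
by rewrite -[X in _ == X]mul1r (inj_eq (mulIf (expfz_neq0 _ (zeta_neq0 _ _)))).
Qed.

Lemma conj_zeta : (zeta R N)^*%C = (zeta R N)^-1.
Proof.
apply: (mulIf (zeta_neq0 R N)); rewrite mulVf ?zeta_neq0// /zeta.
apply/eqP; rewrite eq_complex /=; have := cos2Dsin2 (pi / N%:R : R).
by move=> e; apply/andP; split; apply/eqP; [rewrite -[RHS]e; ring|ring].
Qed.

End Zeta.

(** * Quadratic phases and the five operations *)

Section Sequences.
Context (R : realType) (N : nat) (N1 : (1 < N)%N).
Let N0 : (0 < N)%N := ltnW N1.

Lemma zc_val_congr (u q t t' : int) :
  (N%:Z %| t - t')%Z -> zc_val R N u q t = zc_val R N u q t'.
Proof.
have add_mul (c : nat) s : zc_val R N u q (s + c%:Z * N%:Z) = zc_val R N u q s.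
  elim: c => [|c <-]; first by rewrite mul0r addr0.
  rewrite -(zc_val_periodic _ _ _ (s + c%:Z * _) N0).
  by rewrite -addn1 PoszD mulrDl mul1r addrA.
move=> /dvdzP[[c|c]] E.
  by rewrite -(add_mul c t') -E addrC subrK.
have {}E : c.+1%:Z * N%:Z = t' - t by rewrite -opprB E NegzE mulNr opprK.
by rewrite -(add_mul c.+1 t) E addrC subrK.
Qed.

Lemma val_intr_congr (k : int) : (N%:Z %| (val (k%:~R : 'Z_N))%:Z - k)%Z.
Proof. by rewrite -eq_intr_Zp// val_intr_Zp. Qed.

Lemma zc_seq_intr (u q k : int) :
  zc_seq R N u q k%:~R = zc_val R N u q k.
Proof. by rewrite ffunE; apply/zc_val_congr/val_intr_congr. Qed.

Definition quad_phase (s : {ffun 'Z_N -> R[i]}) : Prop :=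
  exists (c : R[i]) (A B : int), c != 0 /\
    forall k : int, s k%:~R = c * zeta R N ^ (A * k ^+ 2 + B * k).

Lemma seq_equiv_quad_phase (s s' : {ffun 'Z_N -> R[i]}) :
  seq_equiv s s' -> quad_phase s -> quad_phase s'.
Proof.
have z0 := zeta_neq0 R N.
elim=> {s'} // [s' d _ IH d1|s' d _ IH|s' r _ IH _|s' l _ IH|s' _ IH]
  /IH[c [A [B [c0 E]]]].
- exists (d * c), A, B; split=> [|k]; last by rewrite ffunE E mulrA.
  by rewrite mulf_neq0// -normr_eq0 d1 oner_eq0.
- pose x := (val d)%:Z.
  exists (c * zeta R N ^ (A * x ^+ 2 + B * x)), A, (2 * A * x + B).
  split=> [|k]; first by rewrite mulf_neq0// expfz_neq0.
  rewrite ffunE -(val_intr_Zp d) -intrD E -/x -mulrA -expfzDr//.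
  by congr (_ * _ ^ _); ring.
- pose x := (val r)%:Z; exists c, (A * x ^+ 2), (B * x); split=> // k.
  rewrite ffunE -(val_intr_Zp r) -intrM E -/x.
  by congr (_ * _ ^ _); ring.
- pose x := (val l)%:Z; exists c, A, (2 * x + B); split=> // k.
  rewrite ffunE E mulrCA; congr (_ * _).
  rewrite /W -exprM exprnP -[X in X * _ = _]/(_ ^ _) -expfzDr//.
  apply/eqP; rewrite eq_zeta_expz//.
  (* Modulation uses the representative of k in [0, N). It differs from k by a multiple of N, which
     the square in [W] turns into a multiple of 2N. *)
  have /dvdzP[m Em] := val_intr_congr k.
  apply/dvdzP; exists (x * m); rewrite !PoszM -/x.
  by rewrite -[(val (k%:~R : 'Z_N))%:Z](subrK k) Em; ring.
exists (c^*)%C, (- A), (- B); split=> [|k]; first by rewrite conjc_eq0.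
rewrite ffunE E rmorphM; congr (_ * _).
rewrite fmorphXz -[X in X ^ _]/((zeta R N)^*%C) conj_zeta exprz_inv.
by congr (_ ^ _); ring.
Qed.

Lemma zc_seq_quad_phase (u q : int) : quad_phase (zc_seq R N u q).
Proof.
exists 1, u, (u * ((N %% 2)%N%:Z + q *+ 2)).
split=> [|k]; first exact: oner_neq0.
by rewrite zc_seq_intr mul1r /zc_val; congr (_ ^ _); ring.
Qed.

(** The vanishing third difference f(3) - 3 f(2) + 3 f(1) - f(0) of the exponent, written
    multiplicatively without inverses. *)
Lemma quad_phase_diff3 (s : {ffun 'Z_N -> R[i]}) :
  quad_phase s -> s 3 * s 1 ^+ 3 = s 2 ^+ 3 * s 0.
Proof.
move=> [c [A [B [c0 E]]]].
rewrite -[3]/(3%:~R) -[2]/(2%:~R) -[0]/(0%:~R) -[1]/(1%:~R) !E.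
rewrite !exprMn mulrACA [RHS]mulrACA -exprS -exprSr; congr (_ * _).
rewrite !exprnP !exprz_exp -!expfzDr ?zeta_neq0//; congr (_ ^ _); ring.
Qed.

End Sequences.

(** * Equivalence holds exactly when N divides 6a *)

Section Criterion.
Context (R : realType) (N : nat) (a b : 'Z_N) (u q : int).
Hypotheses (N1 : (1 < N)%N) (ab : is_qpp a b) (coun : coprimez u N%:Z).
Let N0 : (0 < N)%N := ltnW N1.
Let a' := (val a)%:Z.
Let b' := (val b)%:Z.
Let e := (N %% 2)%N%:Z.

(** At an odd prime p dividing N, p divides a but not b; at 2, 3a + b has the parity of a + b, which
    is odd. *)
Lemma coprimez_3lead_lin : coprimez (3 * a' + b') N%:Z.
Proof.
apply/coprimez_primeP => // p pp pN; have [p2|p2] := eqVneq p 2%N.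
  rewrite p2 in pN *; rewrite (_ : _ + _ = 2 * a' + (a' + b')); last by ring.
  by rewrite dvdz_addr ?dvdz_mulr// qpp_sum_odd.
by rewrite dvdz_addr ?dvdz_mull ?(qpp_lead_dvd N1 ab)// (qpp_lin_ndvd N1 ab).
Qed.

Lemma qpp_zc_intr (k : int) :
  qpp_zc R u q a b k%:~R = zc_val R N u q (qppz a' b' k).
Proof. by rewrite ffunE qpp_intr zc_seq_intr. Qed.

Lemma zc_equivalent_dvdz :
  zc_equivalent (qpp_zc R u q a b) -> (N%:Z %| 6 * a')%Z.
Proof.
move=> [u' [q' [_ /(seq_equiv_quad_phase _ _ N1) y_quad]]].
have /quad_phase_diff3/eqP := y_quad (zc_seq_quad_phase _ _ N1 _ _).
rewrite -[3]/(3%:~R) -[2]/(2%:~R) -[0]/(0%:~R) -[1]/(1%:~R) !qpp_zc_intr.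
rewrite /zc_val !exprnP !exprz_exp -!expfzDr ?zeta_neq0// eq_zeta_expz//.
(* The third difference at 0; its last factor 2 cancels against the modulus 2N. *)
rewrite (_ : _ - _ = 6 * a' * (u * (3 * a' + b')) * 2); last first.
  by rewrite /qppz; ring.
rewrite PoszM dvdz_mul2r// mulrC (@Gauss_dvdzr _ (u * (3 * a' + b')))//.
by rewrite coprimez_sym coprimezMl coun coprimez_3lead_lin.
Qed.

(* The coefficient of k^2 in the quadratic that agrees with the exponent of the
   permuted sequence at k = 0, 1, 2. *)
Let D := u * (b' ^+ 2 + a' * (7 * a' + 6 * b' + e + q *+ 2)).

(** The cofactor of u is b^2 modulo an odd prime dividing N, and (a + b)^2 modulo 2 when N is even,
    since then e = 0. *)
Lemma coprimez_interp_lead : coprimez D N%:Z.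
Proof.
rewrite coprimezMl coun; apply/coprimez_primeP => // p pp pN.
have [p2|p2] := eqVneq p 2%N.
  rewrite p2 in pN *.
  have -> : e = 0 by rewrite /e; lia.
  rewrite (_ : _ + _ =
      2 * (a' * (3 * a' + 2 * b' + q)) + (a' + b') * (a' + b')).
    rewrite dvdz_addr ?(dvdz_mulr _ (dvdzz 2))//.
    by rewrite Euclid_dvdzM// orbb qpp_sum_odd.
  by ring.
rewrite (addrC (b' ^+ 2)) dvdz_addr; last first.
  by rewrite dvdz_mulr// (qpp_lead_dvd N1 ab).
by rewrite expr2 Euclid_dvdzM// orbb (qpp_lin_ndvd N1 ab).
Qed.

Lemma dvdz_zc_equivalent :
  (N%:Z %| 6 * a')%Z -> zc_equivalent (qpp_zc R u q a b).
Proof.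
move=> /dvdzP[c Hc].
(* The linear coefficient of the same interpolating quadratic. *)
pose B := u * ((e + q *+ 2) * b' - 6 * a' ^+ 2 - 4 * a' * b').
(* A Zadoff-Chu exponent with root D has linear coefficient D (e + 2q'), so 2 q' D must match B - D
   e modulo 2N. This difference is even, and q' then solves q' D = G modulo N. *)
have /dvdzP[G HG] : (2 %| B - D * e)%Z.
  have e01 : e = 0 \/ e = 1 by rewrite /e; lia.
  have -> : B - D * e = u * ((e + q *+ 2) * b' - 6 * a' ^+ 2 - 4 * a' * b'
      - (b' ^+ 2 + a' * (7 * a' + 6 * b' + e + q *+ 2)) * e).
    by rewrite /B /D; ring.
  rewrite dvdz_mull//; case: e01 => ->.
    apply/dvdzP; exists (q * b' - 3 * a' ^+ 2 - 2 * a' * b'); ring.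
  have /dvdzP[x Hx] := dvdz2_mulB1 a'; have /dvdzP[y Hy] := dvdz2_mulB1 b'.
  apply/dvdzP; exists (q * (b' - a') - 5 * a' * b' - a' - 6 * a' ^+ 2 - x - y).
  by rewrite !mulrBl -Hx -Hy; ring.
have [q' /dvdzP[h Hh]] := coprimez_solve D N%:Z G coprimez_interp_lead.
exists D, q'; split; first exact: coprimez_interp_lead.
suff -> : qpp_zc R u q a b = zc_seq R N D q' by exact: SeqEquivRefl.
apply/ffunP => t; rewrite -(val_intr_Zp t) zc_seq_intr// qpp_zc_intr.
set k := (val t)%:Z; apply/eqP; rewrite eq_zeta_expz//.
have /dvdzP[x Hx] := dvdz6_falling k; have /dvdzP[y Hy] := dvdz12_falling k.
(* The falling products supply a factor 12 in all: 6a becomes c N and the other 2 completes 2N. The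
   term h k is the error in solving for q'. *)
apply/dvdzP; exists (u * c * (y * a' + x * b') - h * k).
have -> : u * (qppz a' b' k + e + q *+ 2) * qppz a' b' k
    - D * (k + e + q' *+ 2) * k
  = u * a' * (a' * (k * (k - 1) * (k - 2) * (k + 3))
      + 2 * b' * (k * (k - 1) * (k - 2))) + (B - D * e - 2 * (q' * D)) * k.
  by rewrite /D /B /qppz; ring.
have qD : q' * D = h * N%:Z + G by rewrite -Hh subrK.
rewrite Hy Hx HG qD PoszM.
have -> : u * a' * (a' * (y * 12) + 2 * b' * (x * 6)) =
  u * (6 * a') * (2 * (y * a' + x * b')) by ring.
by rewrite Hc; ring.
Qed.

End Criterion.

(** * Valuations, prime by prime *)

(** Since p^t divides p^alpha, divisibility by p^t can be read off any integer representative. *)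
Lemma nu_geE (N p alpha t : nat) (a : 'Z_N) : (1 < p)%N -> (0 < alpha)%N ->
  (t <= alpha)%N -> nu_ge p alpha a t <-> (p ^ t %| val a)%N.
Proof.
move=> p1 al0 tal.
have pa1 : (1 < p ^ alpha)%N by rewrite -(exp1n alpha) ltn_exp2r.
split=> [[c E]|/dvdnP[c E]]; last by exists c%:R; rewrite -natrM mulnC -E.
have /eqP : (val a)%:Z%:~R = (p ^ t * val c)%N%:Z%:~R :> 'Z_(p ^ alpha).
  by rewrite -!pmulrn E natrM natr_Zp.
have pt : ((p ^ t)%N%:Z %| (p ^ alpha)%N%:Z)%Z by exact: dvdn_exp2l.
rewrite eq_intr_Zp// => /(dvdz_trans pt).
by rewrite rpredBr // PoszM dvdz_mulr.
Qed.

Lemma exactly_dividesE (p alpha N : nat) : prime p -> (0 < N)%N ->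
  exactly_divides p alpha N = (alpha == logn p N).
Proof.
by move=> pp N0; rewrite /exactly_divides !pfactor_dvdn// -ltnNge ltnS eqn_leq.
Qed.

(** The factor 6 absorbs exactly one p when p is 2 or 3 and is prime to p otherwise. *)
Lemma pexp_dvd_6mul (p alpha a : nat) : prime p -> (0 < alpha)%N ->
  (p ^ alpha %| 6 * a)%N = (p ^ eta p alpha %| a)%N.
Proof.
move=> pp; case: alpha => // alpha _; rewrite /eta.
have [->|p2] := eqVneq p 2%N.
  (* Here [alpha] is already the predecessor of the exponent; both cases of [eta] at 2 reduce to
     it. *)
  rewrite (_ : (if _ then _ else _) = alpha); last first.
    by case: alpha => [|n] //=; rewrite subn1.
  by rewrite -(mulnA 2 3 a) expnS dvdn_pmul2l// Gauss_dvdr// coprimeXl.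
have [->|p3] := eqVneq p 3%N.
  by rewrite subn1 -(mulnA 3 2 a) expnS dvdn_pmul2l// Gauss_dvdr// coprimeXl.
rewrite Gauss_dvdr// coprimeXl// (coprimeMr p 2 3) !prime_coprime//.
by rewrite !dvdn_prime2// p2 p3.
Qed.

Theorem theorem1 (R : realType) (N : nat) (a b : 'Z_N) (u q : int) :
  (3 <= N)%N ->
  is_qpp a b ->
  coprimez u N%:Z ->
  (zc_equivalent (qpp_zc R u q a b) <->
   forall p alpha : nat,
     prime p -> (p %| N)%N -> exactly_divides p alpha N ->
     nu_ge p alpha a (eta p alpha)).
Proof.
move=> N3 ab coun; have N1 : (1 < N)%N by exact: ltnW.
have N0 : (0 < N)%N by exact: ltnW.
have eta_le p al : (eta p al <= al)%N.
  by rewrite /eta; do ! case: ifP => // _; rewrite leq_subr.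
have -> : zc_equivalent (qpp_zc R u q a b) <-> (N %| 6 * val a)%N.
  split=> [/zc_equivalent_dvdz|H]; first exact.
  exact: dvdz_zc_equivalent.
split=> [Na p al pp pN|H].
  rewrite exactly_dividesE// => /eqP alE.
  have al0 : (0 < al)%N by rewrite alE logn_gt0 mem_primes pp N0.
  apply/nu_geE; rewrite ?prime_gt1// -pexp_dvd_6mul//.
  by apply: dvdn_trans Na; rewrite alE pfactor_dvdnn.
apply/dvdn_partP => // p; rewrite mem_primes => /and3P[pp _ pN].
have al0 : (0 < logn p N)%N by rewrite logn_gt0 mem_primes pp N0.
rewrite p_part pexp_dvd_6mul//.
apply/(nu_geE _ _ (logn p N)); rewrite ?prime_gt1//.
by apply: H; rewrite // exactly_dividesE.
Qed.
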